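(* Consider the matrix sensing model: $X_\star\in\mathbb{R}^{m\times n}$ is a matrix of rank $r$, $L_1,\dots,L_k\in\mathbb{R}^{m\times n}$ are sensing matrices, $b_i=\langle L_i,X_\star\rangle$ for $i=1,\dots,k$, and $$f(X)=\frac1{2k}\sum_{i=1}^k\big(\langle L_i,X\rangle-b_i\big)^2 .$$ For a positive integer $q$ let $g_q(A,B)=f(AB^\top)$ for $(A,B)\in\mathbb{R}^{m\times q}\times\mathbb{R}^{n\times q}$, and write $g=g_r$. Then: (1) If $(L_1,\dots,L_k)\in\mathcal{L}(\alpha,\beta,r)$ with $\beta<2\alpha$, then for any second-order stationary point (SOSP) $(A,B)$ of $g$, $AB^\top=X_\star$. (2) Define the neighborhood $$\mathcal{N}(X_\star)=\{X\in\mathbb{R}^{m\times n}:\mathrm{rank}(X)\le r,\ \text{and}\ \mathrm{rank}(X)<r\ \text{or}\ \|\nabla f(X)\|<2\alpha\,\sigma_r(X)\}.$$ If $(L_1,\dots,L_k)\in\mathcal{L}(\alpha,\beta,r)$ with $\alpha>0$, then for any SOSP $(A,B)$ of $g$, if $X=AB^\top\in\mathcal{N}(X_\star)$ then $X=X_\star$. (3) If $(L_1,\dots,L_k)\in\mathcal{L}(\alpha',\beta',r')$ with $\alpha'>0$ and $r'>(\beta'/\alpha')^2r$, then for any SOSP $(A,B)$ of the rank-$r'$ factorized objective $g_{r'}$, $g_{r'}(A,B)=0$; and this further implies that $AB^\top=X_\star$.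
   Context: Let $m,n,r,k$ be positive integers with $r\le\min\{m,n\}$. $\|\cdot\|$ is the spectral norm, $\|\cdot\|_F$ the Frobenius norm, $\langle\cdot,\cdot\rangle$ the trace inner product, $\sigma_r(X)$ the $r$-th largest singular value. A differentiable function $h:\mathbb{R}^{m\times n}\to\mathbb{R}$ is $\alpha$-RSC with respect to the rank constraint $r$ if $h(Y)\ge h(X)+\langle\nabla h(X),Y-X\rangle+\frac\alpha2\|X-Y\|_F^2$ for all $X,Y$ with $\mathrm{rank}(X),\mathrm{rank}(Y)\le r$; it is $\beta$-RSM with respect to the rank constraint $r$ if $h(Y)\le h(X)+\langle\nabla h(X),Y-X\rangle+\frac\beta2\|X-Y\|_F^2$ for all such $X,Y$. $\mathcal{L}(\alpha,\beta,r)$ is the set of tuples $(L_1,\dots,L_k)$ of matrices in $\mathbb{R}^{m\times n}$ for which the map $X\mapsto\frac{1}{2k}\sum_{i=1}^k\langle L_i,X\rangle^2$ is $\alpha$-RSC and $\beta$-RSM with respect to the rank constraint $r$. $(A,B)$ is a SOSP of a function $h$ of $(A,B)$ if $\nabla h(A,B)=0$ and $\nabla^2h(A,B)\succeq0$. *)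

(* Defs.v *)
From mathcomp Require Import all_boot all_order all_algebra.
From mathcomp Require Import all_classical all_reals all_analysis.
From mathcomp.real_closed Require polyrcf.

Set Implicit Arguments.
Unset Strict Implicit.
Unset Printing Implicit Defensive.

Import Order.TTheory GRing.Theory Num.Theory.
Import numFieldNormedType.Exports.

Local Open Scope classical_set_scope.
Local Open Scope ring_scope.

Definition mxdot (R : realType) (m n : nat) (X Y : 'M[R]_(m, n)) : R :=
  \tr (X^T *m Y).

Definition frob_norm (R : realType) (m n : nat) (X : 'M[R]_(m, n)) : R :=
  Num.sqrt (\sum_i \sum_j X i j ^+ 2).

(* On column vectors [frob_norm] is the Euclidean norm, so this is the operator
   norm induced by it; the notation [`|X|] is the entrywise maximum instead. *)
Definition spectral_norm (R : realType) (m n : nat) (X : 'M[R]_(m, n)) : R :=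
  sup [set frob_norm (X *m v) | v in [set v : 'cV[R]_n | frob_norm v <= 1]].

(* The square roots of the n eigenvalues of X^T X, with multiplicity, in
   decreasing order; when m < n the last n - m of them are extra zeros. *)
Definition singular_values (R : realType) (m n : nat) (X : 'M[R]_(m, n)) :
    seq R :=
  let p := char_poly (X^T *m X) in
  sort >=%R (flatten [seq nseq (mup a p) (Num.sqrt a) | a <- polyrcf.rootsR p]).

(* The index [i] is 1-based: [sigma X 1] is the largest singular value. *)
Definition sigma (R : realType) (m n : nat) (X : 'M[R]_(m, n)) (i : nat) : R :=
  nth 0 (singular_values X) i.-1.

Definition grad (R : realType) (m n : nat) (h : 'M[R]_(m, n) -> R)
    (X : 'M[R]_(m, n)) : 'M[R]_(m, n) :=
  \matrix_(i, j) 'D_(delta_mx i j) h X.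

Definition RSC (R : realType) (m n : nat) (alpha : R) (r : nat)
    (h : 'M[R]_(m, n) -> R) : Prop :=
  (forall X, differentiable h X) /\
  (forall X Y, (\rank X <= r)%N -> (\rank Y <= r)%N ->
    h X + mxdot (grad h X) (Y - X) + alpha / 2 * frob_norm (X - Y) ^+ 2 <= h Y).

Definition RSM (R : realType) (m n : nat) (beta : R) (r : nat)
    (h : 'M[R]_(m, n) -> R) : Prop :=
  (forall X, differentiable h X) /\
  (forall X Y, (\rank X <= r)%N -> (\rank Y <= r)%N ->
    h Y <= h X + mxdot (grad h X) (Y - X) + beta / 2 * frob_norm (X - Y) ^+ 2).

Definition sensing_form (R : realType) (m n k : nat) (L : 'I_k -> 'M[R]_(m, n))
    (X : 'M[R]_(m, n)) : R :=
  (2 * k%:R)^-1 * \sum_(i < k) mxdot (L i) X ^+ 2.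

Definition sensing_class (R : realType) (m n k : nat) (alpha beta : R)
    (r : nat) : set ('I_k -> 'M[R]_(m, n)) :=
  [set L | RSC alpha r (sensing_form L) /\ RSM beta r (sensing_form L)].

Definition sensing_loss (R : realType) (m n k : nat) (L : 'I_k -> 'M[R]_(m, n))
    (b : 'I_k -> R) (X : 'M[R]_(m, n)) : R :=
  (2 * k%:R)^-1 * \sum_(i < k) (mxdot (L i) X - b i) ^+ 2.

Definition factored (R : realType) (m n q : nat) (f : 'M[R]_(m, n) -> R)
    (Z : 'M[R]_(m, q) * 'M[R]_(n, q)) : R :=
  f (Z.1 *m Z.2^T).

Definition grad_pair (R : realType) (m n q : nat)
    (h : 'M[R]_(m, q) * 'M[R]_(n, q) -> R) (Z : 'M[R]_(m, q) * 'M[R]_(n, q)) :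
    'M[R]_(m, q) * 'M[R]_(n, q) :=
  (\matrix_(i, j) 'D_(delta_mx i j, 0) h Z,
   \matrix_(i, j) 'D_(0, delta_mx i j) h Z).

(* Iterated directional derivative: for h of class C^2 this is the bilinear form
   of the Hessian at Z, evaluated at (U, V). *)
Definition hessian (R : realType) (m n q : nat)
    (h : 'M[R]_(m, q) * 'M[R]_(n, q) -> R) (Z U V : 'M[R]_(m, q) * 'M[R]_(n, q)) :
    R :=
  'D_U (fun W => 'D_V h W) Z.

Definition SOSP (R : realType) (m n q : nat)
    (h : 'M[R]_(m, q) * 'M[R]_(n, q) -> R) (A : 'M[R]_(m, q))
    (B : 'M[R]_(n, q)) : Prop :=
  grad_pair h (A, B) = 0 /\ forall V, 0 <= hessian h (A, B) V V.

(* The ground truth X_star enters only through the loss f. *)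
Definition neighborhood (R : realType) (m n : nat) (alpha : R) (r : nat)
    (f : 'M[R]_(m, n) -> R) : set 'M[R]_(m, n) :=
  [set X | (\rank X <= r)%N /\
           ((\rank X < r)%N \/
            spectral_norm (grad f X) < 2 * alpha * sigma X r)].

(* Main.v *)
(** Write [X = A B^T], [D = X - Xs], [G] for the gradient of [f] at [X] and [Phi] for
    the bilinear form of the sensing map, so that [<G, Y> = Phi (D, Y)].
    Stationarity gives [G B = 0] and [G^T A = 0].  If [X] is rank deficient, some
    [w <> 0] is killed by [A] or [B]; the Hessian is then affine in the scale of a
    direction built on [w], which forces [G = 0], and restricted strong convexity
    gives [D = 0].  Otherwise the Hessian at a direction built on the smallest
    singular pair of [X] and on [G v] gives [|G v| <= beta sigma_q(X) |v|].  As [G]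
    is orthogonal to the row and column spaces of [X], an Eckart-Young type argument
    for [X - t G] shows [- 2 t <G, Xs> <= |D|^2] as soon as
    [t^2 |G|^2 rank(Xs) <= sigma_q(X)^2 q].  Since
    [alpha |D|^2 <= <G, D> = - <G, Xs>], this yields [D = 0] if [1 < 2 t alpha]; the
    three parts of the theorem correspond to three choices of [t]. *)

Require Import Defs.
From mathcomp Require Import all_boot all_order all_algebra.
From mathcomp Require Import all_classical all_reals all_analysis.
From mathcomp.real_closed Require Import complex.
From mathcomp.real_closed Require polyrcf.
From mathcomp Require Import ring lra.

Set Implicit Arguments.
Unset Strict Implicit.
Unset Printing Implicit Defensive.

Import Order.TTheory GRing.Theory Num.Theory.
Import numFieldNormedType.Exports.

Local Open Scope classical_set_scope.
Local Open Scope ring_scope.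

(** * The trace inner product and row-space projections *)

Lemma mxdotE (R : realType) (m n : nat) (X Y : 'M[R]_(m, n)) :
  mxdot X Y = \sum_i \sum_j X i j * Y i j.
Proof.
rewrite /mxdot /mxtrace exchange_big; apply: eq_bigr => j _.
by rewrite mxE; apply: eq_bigr => i _; rewrite mxE.
Qed.

Lemma mxdotC (R : realType) (m n : nat) (X Y : 'M[R]_(m, n)) :
  mxdot X Y = mxdot Y X.
Proof. by rewrite /mxdot -mxtrace_tr trmx_mul trmxK. Qed.

Lemma mxdotDr (R : realType) (m n : nat) (X Y Z : 'M[R]_(m, n)) :
  mxdot X (Y + Z) = mxdot X Y + mxdot X Z.
Proof. by rewrite /mxdot mulmxDr mxtraceD. Qed.

Lemma mxdotZr (R : realType) (m n : nat) (a : R) (X Y : 'M[R]_(m, n)) :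
  mxdot X (a *: Y) = a * mxdot X Y.
Proof. by rewrite /mxdot -scalemxAr mxtraceZ. Qed.

Lemma mxdotNr (R : realType) (m n : nat) (X Y : 'M[R]_(m, n)) :
  mxdot X (- Y) = - mxdot X Y.
Proof. by rewrite -scaleN1r mxdotZr mulN1r. Qed.

Lemma mxdotDl (R : realType) (m n : nat) (X Y Z : 'M[R]_(m, n)) :
  mxdot (Y + Z) X = mxdot Y X + mxdot Z X.
Proof. by rewrite !(mxdotC _ X) mxdotDr. Qed.

Lemma mxdotZl (R : realType) (m n : nat) (a : R) (X Y : 'M[R]_(m, n)) :
  mxdot (a *: Y) X = a * mxdot Y X.
Proof. by rewrite !(mxdotC _ X) mxdotZr. Qed.

Lemma mxdotNl (R : realType) (m n : nat) (X Y : 'M[R]_(m, n)) :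
  mxdot (- Y) X = - mxdot Y X.
Proof. by rewrite !(mxdotC _ X) mxdotNr. Qed.

Lemma mxdot0r (R : realType) (m n : nat) (X : 'M[R]_(m, n)) : mxdot X 0 = 0.
Proof. by rewrite -(scale0r 0) mxdotZr mul0r. Qed.

Lemma mxdot0l (R : realType) (m n : nat) (X : 'M[R]_(m, n)) : mxdot 0 X = 0.
Proof. by rewrite mxdotC mxdot0r. Qed.

Definition mxdot_lin := (mxdotDl, mxdotDr, mxdotNl, mxdotNr, mxdotZl, mxdotZr).

Lemma mxdotMl (R : realType) (m n p : nat) (A : 'M[R]_(m, p)) (B : 'M[R]_(p, n))
    (C : 'M[R]_(m, n)) :
  mxdot (A *m B) C = mxdot B (A^T *m C).
Proof. by rewrite /mxdot trmx_mul mulmxA. Qed.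

Lemma mxdotMr (R : realType) (m n p : nat) (A : 'M[R]_(m, p)) (B : 'M[R]_(p, n))
    (C : 'M[R]_(m, n)) :
  mxdot (A *m B) C = mxdot A (C *m B^T).
Proof. by rewrite /mxdot trmx_mul -mulmxA mxtrace_mulC mulmxA. Qed.

Lemma mxdot_delta (R : realType) (m n : nat) (X : 'M[R]_(m, n)) i j :
  mxdot X (delta_mx i j) = X i j.
Proof.
rewrite mxdotE (bigD1 i) //= (bigD1 j) //= mxE !eqxx mulr1.
rewrite !big1 ?addr0 // => [a /negPf ai|b /negPf bj].
  by apply: big1 => b _; rewrite mxE ai mulr0.
by rewrite mxE bj andbF mulr0.
Qed.

Lemma mxdot_ge0 (R : realType) (m n : nat) (X : 'M[R]_(m, n)) : 0 <= mxdot X X.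
Proof.
by rewrite mxdotE; apply: sumr_ge0 => i _; apply: sumr_ge0 => j _; exact: sqr_ge0.
Qed.

Lemma mxdot_eq0 (R : realType) (m n : nat) (X : 'M[R]_(m, n)) :
  (mxdot X X == 0) = (X == 0).
Proof.
apply/eqP/eqP => [|->]; last by rewrite mxdot0r.
rewrite mxdotE => /eqP; rewrite psumr_eq0 => [/allP X0|i _]; last first.
  by apply: sumr_ge0 => j _; exact: sqr_ge0.
apply/matrixP => i j; rewrite mxE; apply/eqP.
have /implyP/(_ isT) := X0 i (mem_index_enum i).
rewrite psumr_eq0 => [/allP/(_ j (mem_index_enum j))|k _]; last exact: sqr_ge0.
by rewrite -expr2 sqrf_eq0.
Qed.

Lemma mxdot_gt0 (R : realType) (m n : nat) (X : 'M[R]_(m, n)) :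
  (0 < mxdot X X) = (X != 0).
Proof. by rewrite lt_def mxdot_ge0 mxdot_eq0 andbT. Qed.

Lemma frob_norm_ge0 (R : realType) (m n : nat) (X : 'M[R]_(m, n)) :
  0 <= frob_norm X.
Proof. exact: sqrtr_ge0. Qed.

Lemma sqr_frob_norm (R : realType) (m n : nat) (X : 'M[R]_(m, n)) :
  frob_norm X ^+ 2 = mxdot X X.
Proof.
have -> : frob_norm X = Num.sqrt (mxdot X X) by rewrite mxdotE.
by rewrite sqr_sqrtr // mxdot_ge0.
Qed.

Lemma mxdot_col (R : realType) (m n : nat) (X : 'M[R]_(m, n)) :
  mxdot X X = \sum_j mxdot (col j X) (col j X).
Proof.
rewrite mxdotE exchange_big; apply: eq_bigr => j _.
by rewrite mxdotE; apply: eq_bigr => i _; rewrite big_ord1 !mxE.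
Qed.

(** Squared Frobenius norms add up over columns, so a comparison of two quadratic forms on vectors
    passes to any right factor. *)
Lemma mxdot_mul_mono (R : realType) (m p q n : nat) (A : 'M[R]_(m, n))
    (B : 'M[R]_(p, n)) (C : 'M[R]_(n, q)) (c d : R) :
  (forall v : 'cV[R]_n,
     c * mxdot (A *m v) (A *m v) <= d * mxdot (B *m v) (B *m v)) ->
  c * mxdot (A *m C) (A *m C) <= d * mxdot (B *m C) (B *m C).
Proof.
move=> AB; rewrite (mxdot_col (A *m C)) (mxdot_col (B *m C)) !mulr_sumr.
by apply: ler_sum => j _; rewrite !colE -!mulmxA.
Qed.

(** Idempotence of [E = col_base E *m row_base E] cancels to [row_base E *m col_base E = 1%:M], an
    identity of size [\rank E], and the trace does not see the order of the factors. *)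
Lemma mxtrace_idem (F : fieldType) (n : nat) (E : 'M[F]_n) :
  E *m E = E -> \tr E = (\rank E)%:R.
Proof.
move=> EE; rewrite -[in LHS](mulmx_base E) mxtrace_mulC.
suff -> : row_base E *m col_base E = 1%:M by rewrite mxtrace1.
have := EE; rewrite -{1 2 3}(mulmx_base E) mulmxA.
move=> /row_free_inj -/(_ (row_base_free E)).
rewrite -mulmxA -[RHS]mulmx1 => /row_full_inj; apply; exact: col_base_full.
Qed.

(** The orthogonal projection onto the row space of [Y]. A row basis is used because the Gram matrix
    of [Y] itself may be singular. *)
Definition row_proj (R : realType) (m n : nat) (Y : 'M[R]_(m, n)) : 'M[R]_n :=
  (row_base Y)^T *m invmx (row_base Y *m (row_base Y)^T) *m row_base Y.

Lemma mulmx_tr_eq0 (R : realType) (m n : nat) (Y : 'M[R]_(m, n)) :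
  Y *m Y^T = 0 -> Y = 0.
Proof.
by move=> YY; apply/eqP; rewrite -mxdot_eq0 /mxdot mxtrace_mulC YY mxtrace0.
Qed.

Lemma gram_unitmx (R : realType) (m n : nat) (E : 'M[R]_(m, n)) :
  row_free E -> E *m E^T \in unitmx.
Proof.
move=> Efree; rewrite -row_free_unit -kermx_eq0; apply/rowV0P => u /sub_kermxP uEE.
have: (u *m E) *m (u *m E)^T = 0.
  by rewrite trmx_mul -mulmxA (mulmxA E) mulmxA uEE mul0mx.
by move/mulmx_tr_eq0/eqP; rewrite mulmx_free_eq0 // => /eqP.
Qed.

Lemma row_proj_tr (R : realType) (m n : nat) (Y : 'M[R]_(m, n)) :
  (row_proj Y)^T = row_proj Y.
Proof.
rewrite /row_proj; move: (row_base Y) => E.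
by rewrite !trmx_mul trmx_inv trmx_mul !trmxK mulmxA.
Qed.

Lemma row_proj_sub (R : realType) (m n : nat) (Y : 'M[R]_(m, n)) :
  (row_proj Y <= Y)%MS.
Proof. by rewrite (submx_trans (submxMl _ _)) // eq_row_base. Qed.

Lemma mul_row_proj (R : realType) (m n : nat) (Y : 'M[R]_(m, n)) :
  Y *m row_proj Y = Y.
Proof.
rewrite -{1 3}(mulmx_base Y) /row_proj.
have := gram_unitmx (row_base_free Y).
move: (row_base Y) (col_base Y) => E C EE.
by rewrite -2!mulmxA (mulmxA E) (mulmxA (E *m _)) mulmxV // mul1mx.
Qed.

Lemma row_proj_idem (R : realType) (m n : nat) (Y : 'M[R]_(m, n)) :
  row_proj Y *m row_proj Y = row_proj Y.
Proof.
by have /submxP[D E] := row_proj_sub Y; rewrite {1}E -mulmxA mul_row_proj -E.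
Qed.

Lemma rank_row_proj (R : realType) (m n : nat) (Y : 'M[R]_(m, n)) :
  \rank (row_proj Y) = \rank Y.
Proof.
apply/eqP; rewrite eqn_leq mxrankS ?row_proj_sub //=.
by rewrite -{1}(mul_row_proj Y) mxrankM_maxr.
Qed.

Lemma mxdot_row_proj (R : realType) (m n : nat) (Y : 'M[R]_(m, n)) :
  mxdot (row_proj Y) (row_proj Y) = (\rank Y)%:R.
Proof.
by rewrite /mxdot row_proj_tr row_proj_idem mxtrace_idem ?rank_row_proj ?row_proj_idem.
Qed.

Lemma mul_row_proj_ortho (R : realType) (m n p : nat) (Y : 'M[R]_(m, n))
    (G : 'M[R]_(p, n)) :
  G *m Y^T = 0 -> G *m row_proj Y = 0.
Proof.
have /submxP[D DE] := row_proj_sub Y; rewrite -row_proj_tr DE trmx_mul mulmxA => ->.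
by rewrite mul0mx.
Qed.

(** Pythagoras for the orthogonal projection [P] acting on the rows of [A]. *)
Lemma mxdot_proj_split (R : realType) (m n : nat) (A : 'M[R]_(m, n)) (P : 'M[R]_n) :
  P^T = P -> P *m P = P ->
  mxdot A A = mxdot (A *m P) (A *m P) + mxdot (A *m (1%:M - P)) (A *m (1%:M - P)).
Proof.
move=> PT PP.
have H : mxdot (A *m P) (A *m P) = mxdot A (A *m P) by rewrite mxdotMr PT -mulmxA PP.
by rewrite mulmxBr mulmx1 !mxdot_lin H (mxdotC (A *m P)); ring.
Qed.

(* Compare [X - t G] with its projection onto the orthogonal of the row space of
   [Y]; when [t tau <= sqrt lam] and [\rank Y <= \rank X] this is the
   Eckart-Young inequality [|X - tG - X| <= |X - tG - Y|]. *)
Lemma low_rank_ineq (R : realType) (m n : nat) (X Y G : 'M[R]_(m, n))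
    (lam tau2 t : R) :
  X^T *m G = 0 -> G *m X^T = 0 -> 0 <= lam ->
  (forall v : 'cV[R]_n, mxdot (G *m v) (G *m v) <= tau2 * mxdot v v) ->
  (forall w : 'cV[R]_n, (w^T <= X)%MS -> lam * mxdot w w <= mxdot (X *m w) (X *m w)) ->
  (\rank Y <= \rank X)%N -> t ^+ 2 * tau2 * (\rank Y)%:R <= lam * (\rank X)%:R ->
  0 <= mxdot (X - Y) (X - Y) + 2 * t * mxdot G Y.
Proof.
move=> XG GX lam0 Gle Xge rkYX tle.
set P := row_proj Y; set Q := row_proj X.
have PT : P^T = P := row_proj_tr Y.
have PP : P *m P = P := row_proj_idem Y.
have QT : Q^T = Q := row_proj_tr X.
have QQ : Q *m Q = Q := row_proj_idem X.
have GQ : G *m Q = 0 := mul_row_proj_ortho GX.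
have XQ : X *m Q = X := mul_row_proj X.
have YP : Y *m P = Y := mul_row_proj Y.
have trP : mxdot P P = (\rank Y)%:R := mxdot_row_proj Y.
have trQ : mxdot Q Q = (\rank X)%:R := mxdot_row_proj X.
have QX : (Q <= X)%MS := row_proj_sub X.
clearbody P Q => {GX}.
(* [pi] measures the overlap of the two row spaces: it is the sum of the squared cosines of their
   principal angles. *)
set pi := mxdot (Q *m P) (Q *m P).
have pi_ge0 : 0 <= pi := mxdot_ge0 _.
have piQ : mxdot (Q *m (1%:M - P)) (Q *m (1%:M - P)) = (\rank X)%:R - pi.
  by rewrite -trQ (mxdot_proj_split Q PT PP) -/pi; ring.
have piP : mxdot ((1%:M - Q) *m P) ((1%:M - Q) *m P) = (\rank Y)%:R - pi.
  rewrite -trP mulmxBl mul1mx !mxdot_lin -/pi.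
  have -> : mxdot P (Q *m P) = pi by rewrite /pi mxdotMl QT mulmxA QQ.
  by rewrite (mxdotC _ P) /pi mxdotMl QT mulmxA QQ; ring.
have pi_le : pi <= (\rank Y)%:R by rewrite -subr_ge0 -piP mxdot_ge0.
(* As [X = X *m Q], only [Q *m (1%:M - P)] matters, and its columns lie in the row space of [X],
   where [Xge] applies. *)
have h1 : lam * ((\rank X)%:R - pi) <=
    mxdot (X *m (1%:M - P)) (X *m (1%:M - P)).
  rewrite -piQ -[leRHS]mul1r; apply: mxdot_mul_mono => v; rewrite mul1r.
  rewrite -{1 2}XQ -!mulmxA; apply: Xge.
  by rewrite trmx_mul QT (submx_trans (submxMl _ _)).
(* Dually, [G] kills [Q] and only sees [(1%:M - Q) *m P]. *)
have h2 : mxdot (G *m P) (G *m P) <= tau2 * ((\rank Y)%:R - pi).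
  rewrite -piP -[leLHS]mul1r; apply: mxdot_mul_mono => v; rewrite mul1r.
  have -> : G *m v = G *m ((1%:M - Q) *m v) by rewrite mulmxA mulmxBr GQ subr0 mulmx1.
  exact: Gle.
set D := X - t *: G.
have GXv p (u v : 'M[R]_(n, p)) : mxdot (G *m u) (X *m v) = 0.
  have -> : mxdot (G *m u) (X *m v) = mxdot u ((X^T *m G)^T *m v).
    by rewrite trmx_mul trmxK mxdotMl mulmxA.
  by rewrite XG trmx0 mul0mx mxdot0r.
have GX0 : mxdot G X = 0 by have := GXv n 1%:M 1%:M; rewrite !mulmx1.
(* [1%:M - P] annihilates [Y] and does not increase the norm. *)
have hD : mxdot (D *m (1%:M - P)) (D *m (1%:M - P)) <= mxdot (D - Y) (D - Y).
  rewrite [leRHS](mxdot_proj_split _ PT PP).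
  rewrite [X in _ <= _ + mxdot X X]mulmxBl [X in D *m _ - X]mulmxBr.
  by rewrite mulmx1 YP subrr subr0 lerDr mxdot_ge0.
have E1 : mxdot (D *m (1%:M - P)) (D *m (1%:M - P)) =
    mxdot (X *m (1%:M - P)) (X *m (1%:M - P)) +
    t ^+ 2 * (mxdot G G - mxdot (G *m P) (G *m P)).
  rewrite (mxdot_proj_split G PT PP) /D mulmxBl -scalemxAl.
  rewrite !(mxdotDl _ (X *m _)) !(mxdotDr (X *m _)) !mxdot_lin.
  by rewrite (mxdotC (X *m _) (G *m _)) !GXv; ring.
have E2 : mxdot (D - Y) (D - Y) =
    mxdot (X - Y) (X - Y) + 2 * t * mxdot G Y + t ^+ 2 * mxdot G G.
  rewrite /D !mxdot_lin (mxdotC X G) (mxdotC Y G) (mxdotC Y X) GX0; ring.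
have t2 : 0 <= t ^+ 2 := sqr_ge0 t.
have rk : (\rank Y)%:R <= (\rank X)%:R :> R by rewrite ler_nat.
have h2' := ler_wpM2l t2 h2.
(* If [t ^+ 2 * tau2 <= lam], the bounds [pi <= \rank Y <= \rank X] suffice. Otherwise [pi] has a
   positive coefficient, and dropping it leaves the rank hypothesis [tle]. *)
have : 0 <= lam * ((\rank X)%:R - pi) - t ^+ 2 * (tau2 * ((\rank Y)%:R - pi)).
  have [c|c] := lerP (t ^+ 2 * tau2) lam.
    have : t ^+ 2 * tau2 * ((\rank Y)%:R - pi) <= lam * ((\rank Y)%:R - pi).
      by rewrite ler_wpM2r // subr_ge0.
    have : lam * (\rank Y)%:R <= lam * (\rank X)%:R by rewrite ler_wpM2l.
    lra.
  have : 0 <= (t ^+ 2 * tau2 - lam) * pi by rewrite mulr_ge0 // subr_ge0 ltW.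
  lra.
lra.
Qed.

(** * Singular values *)

Lemma char_poly_conj (F : fieldType) (n : nat) (P Q D : 'M[F]_n) :
  Q *m P = 1%:M -> char_poly (Q *m D *m P) = char_poly D.
Proof.
move=> QP; rewrite /char_poly.
have QP' : map_mx polyC Q *m map_mx polyC P = 1%:M by rewrite -map_mxM QP map_mx1.
have -> : char_poly_mx (Q *m D *m P) =
    map_mx polyC Q *m char_poly_mx D *m map_mx polyC P.
  rewrite /char_poly_mx mulmxBr mulmxBl -!map_mxM; congr (_ - _).
  by rewrite -mulmxA mul_scalar_mx -scalemxAr QP' scalemx1.
rewrite !det_mulmx mulrAC -det_mulmx QP' det1 mul1r //.
Qed.

Lemma char_poly_diag (F : fieldType) (n : nat) (d : 'rV[F]_n) :
  char_poly (diag_mx d) = \prod_i ('X - (d 0 i)%:P).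
Proof.
rewrite char_poly_trig ?diag_mx_is_trig //.
by apply: eq_bigr => i _; rewrite mxE eqxx mulr1n.
Qed.

(** [diag_mx d] and the diagonal of its 0/1 support are multiples of each other; the latter is
    idempotent, so its rank is its trace. *)
Lemma rank_diag_mx (F : numFieldType) (n : nat) (d : 'rV[F]_n) :
  \rank (diag_mx d) = #|[pred i | d 0 i != 0]|.
Proof.
set e : 'rV[F]_n := \row_i (d 0 i != 0)%:R.
have -> : \rank (diag_mx d) = \rank (diag_mx e).
  apply/eqP; rewrite eqn_leq; apply/andP; split.
    have -> : diag_mx d = diag_mx e *m diag_mx d.
      rewrite mulmx_diag; congr diag_mx; apply/rowP => i; rewrite !mxE.
      by have [->|_] := eqVneq (d 0 i) 0; rewrite ?mulr0 ?mul1r.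
    exact: mxrankM_maxl.
  have -> : diag_mx e = diag_mx d *m diag_mx (map_mx GRing.inv d).
    rewrite mulmx_diag; congr diag_mx; apply/rowP => i; rewrite !mxE.
    by have [->|d0] := eqVneq (d 0 i) 0; rewrite ?mul0r // divff.
  exact: mxrankM_maxl.
apply/eqP; rewrite -(eqr_nat F) -mxtrace_idem.
  rewrite mxtrace_diag -sum1_card natr_sum [eqbRHS]big_mkcond /=.
  by apply/eqP/eq_bigr => i _; rewrite mxE inE; case: (d 0 i == 0).
rewrite mulmx_diag; congr diag_mx; apply/rowP => i; rewrite !mxE.
by rewrite -natrM mulnb andbb.
Qed.

(** Rank is lost only on the part of the row space of [X^T] killed by [X]; a vector [u] there
    satisfies [u *m u^T = 0]. *)
Lemma rank_gram (R : realType) (m n : nat) (X : 'M[R]_(m, n)) :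
  \rank (X^T *m X) = \rank X.
Proof.
rewrite -(mxrank_tr X) -(mxrank_mul_ker X^T X).
suff -> : (X^T :&: kermx X)%MS = 0 by rewrite mxrank0 addn0.
apply/eqP/rowV0P => u; rewrite sub_capmx => /andP[/submxP[z ->] /sub_kermxP zX].
by apply: mulmx_tr_eq0; rewrite trmx_mul trmxK mulmxA zX mul0mx.
Qed.

Local Open Scope sesquilinear_scope.

(* [X^T X] is diagonalised over [R[i]], then only real data are kept. *)
Lemma gram_spectral (R : realType) (m n : nat) (X : 'M[R]_(m, n)) :
  exists d : 'rV[R]_n,
  [/\ char_poly (X^T *m X) = \prod_i ('X - (d 0 i)%:P),
      forall i, 0 <= d 0 i,
      #|[pred i | d 0 i != 0]| = \rank X
    & forall lam, (forall i, d 0 i != 0 -> lam <= d 0 i) ->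
      forall w : 'cV[R]_n, (w^T <= X)%MS ->
        lam * mxdot w w <= mxdot (X *m w) (X *m w)].
Proof.
pose toC : {rmorphism R -> R[i]} := real_complex R.
have toC_tc p q (A : 'M[R]_(p, q)) : (map_mx toC A)^t* = map_mx toC A^T.
  rewrite map_trmx -map_mx_comp; apply/matrixP => i j; rewrite !mxE.
  exact: conjc_real.
set XC := map_mx toC X; set A := X^T *m X; set AC := map_mx toC A.
have ACE : AC = XC^t* *m XC by rewrite toC_tc -map_mxM.
have Aherm : AC \is hermsymmx.
  apply/is_hermitianmxP; rewrite expr0 scale1r toC_tc.
  by rewrite /A trmx_mul trmxK.
have /hermitian_normalmx/orthomx_spectralP := Aherm.
have := hermitian_spectral_diag_real Aherm.
have := spectral_unitarymx AC.
move: (spectralmx AC) (spectral_diag AC) => P dC Puni /mxOverP dreal.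
rewrite invmx_unitary // => AE.
have PPt : P *m P^t* = 1%:M by exact/unitarymxP.
have PtP : P^t* *m P = 1%:M by rewrite mulmx1C.
pose d : 'rV[R]_n := map_mx (@complex.Re R) dC.
have dE i : dC 0 i = toC (d 0 i) by rewrite mxE [RHS]RRe_real.
clearbody d.
have PA : P *m AC = diag_mx dC *m P by rewrite AE 2!mulmxA PPt mul1mx.
(* [y i] is the image under [X] of the [i]-th eigenvector, written as a row. Its squared norm is the
   [i]-th eigenvalue, which is therefore nonnegative, and [y i] vanishes with it. *)
pose y i : 'rV_m := row i P *m XC^t*.
have yE i : (y i *m (y i)^t*) 0 0 = dC 0 i.
  rewrite /y trmx_mul map_mxM trmxCK -mulmxA (mulmxA _ XC) -ACE !mulmxA.
  rewrite -row_mul PA row_mul row_diag_mx -!scalemxAl -rowE mxE.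
  have -> : row i P *m (row i P)^t* = (P *m P^t*) i i *: 1%:M.
    apply/matrixP => a b; rewrite !ord1 !mxE mulr1.
    by apply: eq_bigr => k _; rewrite !mxE.
  by rewrite PPt !mxE eqxx !mulr1.
have yyE i : (y i *m (y i)^t*) 0 0 = \sum_j `|y i 0 j| ^+ 2.
  by rewrite mxE; apply: eq_bigr => j _; rewrite !mxE normCK.
have d_ge0 i : 0 <= d 0 i.
  by rewrite -lecR -dE -yE yyE sumr_ge0 // => j _; rewrite exprn_ge0.
have y0 i : d 0 i = 0 -> y i = 0.
  move=> di0; apply/rowP => j; rewrite [RHS]mxE.
  have := yyE i; rewrite yE dE di0 rmorph0 => /esym/eqP.
  rewrite psumr_eq0 => [/allP/(_ j (mem_index_enum j))|k _]; last by rewrite exprn_ge0.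
  by rewrite sqrf_eq0 normr_eq0 => /eqP.
exists d; split => //.
- apply: (map_inj_poly (@complexI R) (rmorph0 _)); rewrite map_char_poly -/toC -/AC AE.
  rewrite char_poly_conj // char_poly_diag rmorph_prod; apply: eq_bigr => i _.
  by rewrite rmorphB /= map_polyX map_polyC dE.
- rewrite -rank_gram -/A -(mxrank_map toC) -/AC AE.
  have [uPt uP] := mulmx1_unit PtP.
  rewrite mxrankMfree ?row_free_unit //.
  have fPt : row_full (P^t*) by rewrite row_full_unit.
  rewrite (eqmxMfull _ fPt).
  by rewrite rank_diag_mx; apply: eq_card => i; rewrite !inE dE fmorph_eq0.
move=> lam lam_le w /submxP[z wE].
have {wE}wE : w = X^T *m z^T by rewrite -[w]trmxK wE trmx_mul.
have mxdotC' p (v : 'cV[R]_p) :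
    toC (mxdot v v) = ((map_mx toC v)^t* *m map_mx toC v) 0 0.
  by rewrite toC_tc -map_mxM [RHS]mxE /mxdot trace_mx11.
have [wC [zC [wwE XwE wzE]]] : exists (wC : 'cV[R[i]]_n) (zC : 'cV[R[i]]_m),
    [/\ toC (mxdot w w) = (wC^t* *m wC) 0 0,
        toC (mxdot (X *m w) (X *m w)) = ((XC *m wC)^t* *m (XC *m wC)) 0 0
      & wC = XC^t* *m zC].
  exists (map_mx toC w), (map_mx toC z^T).
  by split; rewrite ?mxdotC' ?map_mxM // toC_tc -map_mxM -wE.
pose u := P *m wC.
have uT : wC^t* *m P^t* = u^t* by rewrite /u trmx_mul map_mxM.
have uE : toC (mxdot w w) = \sum_i `|u i 0| ^+ 2.
  rewrite wwE -[X in _ *m X]mul1mx -PtP -mulmxA -/u mulmxA uT.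
  by rewrite mxE; apply: eq_bigr => i _; rewrite !mxE normCK mulrC.
have {}XwE : toC (mxdot (X *m w) (X *m w)) = \sum_i toC (d 0 i) * `|u i 0| ^+ 2.
  rewrite XwE trmx_mul map_mxM -mulmxA (mulmxA _ XC) -ACE AE.
  rewrite -!mulmxA -/u (mulmxA _ (P^t*)) uT.
  rewrite mxE; apply: eq_bigr => i _; rewrite mul_diag_mx !mxE -dE normCK.
  by rewrite mulrCA; congr (_ * _); exact: mulrC.
rewrite -lecR rmorphM /= -/toC uE XwE mulr_sumr; apply: ler_sum => i _.
have [di0|di0] := eqVneq (d 0 i) 0; last first.
  by rewrite ler_wpM2r ?exprn_ge0 // lecR lam_le.
(* Since [w] lies in the range of [X^T], its coordinate along the [i]-th eigenvector factors through
   [y i], which is zero here. *)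
suff -> : u i 0 = 0 by rewrite normr0 expr0n /= !mulr0.
have -> : u i 0 = (y i *m zC) 0 0.
  by rewrite /y -mulmxA -wzE -row_mul [RHS]mxE.
by rewrite y0 // mul0mx mxE.
Qed.

Local Close Scope sesquilinear_scope.

Lemma prod_XsubC_neq0 (F : fieldType) (s : seq F) :
  \prod_(a <- s) ('X - a%:P) != 0.
Proof. exact/monic_neq0/monic_prod_XsubC. Qed.

Lemma mup_prod_XsubC (F : fieldType) (s : seq F) (x : F) :
  mup x (\prod_(a <- s) ('X - a%:P)) = count_mem x s.
Proof.
elim: s => [|a s IH]; first by rewrite big_nil mupNroot // root1.
rewrite big_cons mupM ?polyXsubC_eq0 ?prod_XsubC_neq0 // IH /=.
by rewrite -[_ - _]expr1 mup_XsubCX; case: eqP.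
Qed.

(** The real roots of the product are the distinct elements of [s], and multiplicity is the number
    of occurrences, so repeating each root rebuilds [s] up to order. *)
Lemma perm_singular_values (R : realType) (m n : nat) (X : 'M[R]_(m, n))
    (s : seq R) :
  char_poly (X^T *m X) = \prod_(a <- s) ('X - a%:P) ->
  perm_eq (singular_values X) (map Num.sqrt s).
Proof.
move=> pE; rewrite /singular_values perm_sort pE.
set p := \prod_(a <- s) _; have p0 : p != 0 := prod_XsubC_neq0 s.
have -> : [seq nseq (mup a p) (Num.sqrt a) | a <- polyrcf.rootsR p] =
    [seq map Num.sqrt v | v <- [seq nseq (count_mem a s) a | a <- polyrcf.rootsR p]].
  by rewrite -map_comp; apply: eq_map => a /=; rewrite mup_prod_XsubC map_nseq.
rewrite -map_flatten perm_map // (perm_trans _ (perm_count_undup s)) //.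
apply/perm_flatten/perm_map/uniq_perm; rewrite ?undup_uniq ?polyrcf.uniq_roots //.
move=> x; rewrite mem_undup -[RHS]root_prod_XsubC -/p.
by have := polyrcf.roots_on_rootsR p0 x; rewrite in_itv.
Qed.

(** In a decreasing list the elements satisfying an upward closed predicate form a prefix. *)
Lemma sorted_nth_count (d : Order.disp_t) (T : orderType d) (x0 : T) (s : seq T)
    (P : pred T) (i : nat) :
  (forall x y, (x <= y)%O -> P x -> P y) -> sorted >=%O s -> (i < size s)%N ->
  P (nth x0 s i) = (i < count P s)%N.
Proof.
move=> Pup; elim: s i => // x s IH i; rewrite /= (path_sortedE ge_trans).
move=> /andP[/allP xs s_sorted].
have [Px|nPx] := boolP (P x); first by case: i => [|i] //= lt_i; rewrite IH.
have c0 : count P s = 0%N.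
  apply/eqP; rewrite -leqn0 leqNgt -has_count.
  by apply/hasPn => y /xs /Pup/contra; apply.
by case: i => [|i] /= lt_i; rewrite c0 ?(negPf nPx) // IH // c0.
Qed.

(* [X^T X] has exactly [\rank X] nonzero eigenvalues, so the smallest of them is
   [sigma X (\rank X) ^+ 2]. *)
Lemma sigma_rank (R : realType) (m n : nat) (X : 'M[R]_(m, n)) :
  (0 < \rank X)%N ->
  let s := sigma X (\rank X) in
  [/\ 0 < s,
      exists2 v : 'cV[R]_n, v != 0 & X^T *m X *m v = s ^+ 2 *: v
    & forall w : 'cV[R]_n, (w^T <= X)%MS ->
        s ^+ 2 * mxdot w w <= mxdot (X *m w) (X *m w)].
Proof.
move=> rX s; have [d [dchar d_ge0 dcount dle]] := gram_spectral X.
pose l := [seq d 0 i | i : 'I_n].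
have mem_l i : d 0 i \in l by apply/mapP; exists i; rewrite ?mem_enum.
have {}dchar : char_poly (X^T *m X) = \prod_(a <- l) ('X - a%:P).
  by rewrite dchar /l big_image.
have perm := perm_singular_values dchar.
set sv := singular_values X in perm.
have sv_sorted : sorted >=%R sv by apply: sort_sorted; exact: ge_total.
have sv_pos : count (fun x => 0 < x) sv = \rank X.
  rewrite (permP perm) count_map -dcount cardE size_filter /l count_map.
  by rewrite enumT; apply: eq_count => i /=; rewrite sqrtr_gt0 lt_def d_ge0 andbT.
have lt_sv : ((\rank X).-1 < size sv)%N.
  by rewrite prednK // -sv_pos count_size.
have sE : s = nth 0 sv (\rank X).-1 by [].
have s_gt0 : 0 < s.
  have up (y z : R) : y <= z -> 0 < y -> 0 < z by move=> yz /lt_le_trans; apply.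
  by rewrite sE (sorted_nth_count 0 up sv_sorted lt_sv) sv_pos prednK.
have s_min x : x \in sv -> 0 < x -> s <= x.
  move=> x_sv x_gt0; rewrite leNgt sE.
  have up (y z : R) : y <= z -> x < y -> x < z by move=> yz /lt_le_trans; apply.
  rewrite (sorted_nth_count 0 up sv_sorted lt_sv).
  rewrite -leqNgt -ltnS prednK // -sv_pos.
  (* The elements above [x] and the copies of [x] are all positive, so there are at most [\rank X]
     of them. As [x] occurs, fewer than [\rank X] elements exceed it, and the one at index
     [(\rank X).-1] does not. *)
  have x_ge1 : (0 < count_mem x sv)%N by rewrite -has_count has_pred1.
  have : (count (fun y => (x < y)%R) sv + count_mem x sv
      <= count (fun y => (0 < y)%R) sv)%N.
    rewrite -count_predUI [X in (_ + X)%N](_ : _ = 0%N) ?addn0.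
      by apply: sub_count => y /orP[/(lt_trans x_gt0)|/eqP ->].
    by apply/eqP; rewrite -leqn0 leqNgt -has_count; apply/hasPn => y _ /=; case: ltgtP.
  by apply: leq_trans; rewrite -[ltnLHS]addn0 ltn_add2l.
have [i di] : exists i, s = Num.sqrt (d 0 i).
  have : s \in sv by rewrite sE mem_nth.
  by rewrite (perm_mem perm) => /mapP[_ /mapP[i _ ->] ->]; exists i.
have s2 : s ^+ 2 = d 0 i by rewrite di sqr_sqrtr.
split => //.
  have : eigenvalue (X^T *m X) (s ^+ 2).
    by rewrite eigenvalue_root_char dchar root_prod_XsubC s2 mem_l.
  move/eigenvalueP => [v vE v0]; exists v^T; first by rewrite trmx_eq0.
  by move: vE => /(congr1 trmx); rewrite !trmx_mul trmxK linearZ.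
move=> w; apply: dle => j dj.
rewrite -[leRHS]sqr_sqrtr // ler_pXn2r ?nnegrE ?sqrtr_ge0 ?(ltW s_gt0) //.
apply: s_min; last by rewrite sqrtr_gt0 lt_def d_ge0 dj.
by rewrite (perm_mem perm) map_f.
Qed.

(** * Derivatives of the sensing loss *)

(** A directional derivative depends only on the restriction to a line. The derivatives below are
    all computed by exhibiting that restriction as a polynomial in [t]. *)
Lemma derive_horner_line (R : realType) (V : normedModType R) (f : V -> R)
    (a v : V) (p : {poly R}) :
  (forall t, f (a + t *: v) = p.[t]) -> 'D_v f a = p`_1.
Proof.
move=> fE; transitivity ('D_1 (horner p) (0 : R)).
  rewrite /derive; under [in LHS]eq_fun do rewrite /= (addrC _ a) fE.
  under [in RHS]eq_fun do rewrite /= addr0 [_ *: 1]mulr1.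
  by have := fE 0; rewrite scale0r addr0 => ->.
by rewrite -derive1E -derivE horner_coef0 coef_deriv mulr1n.
Qed.

(** The Hessian form of the sensing loss, normalised so that [sensing_form L] is half of its
    diagonal. *)
Definition sensing_bilin (R : realType) (m n k : nat) (L : 'I_k -> 'M[R]_(m, n))
    (X Y : 'M[R]_(m, n)) : R :=
  k%:R^-1 * \sum_i mxdot (L i) X * mxdot (L i) Y.

Lemma sensing_bilinC (R : realType) (m n k : nat) (L : 'I_k -> 'M[R]_(m, n)) X Y :
  sensing_bilin L X Y = sensing_bilin L Y X.
Proof. by congr (_ * _); apply: eq_bigr => i _; exact: mulrC. Qed.

Lemma sensing_bilinDr (R : realType) (m n k : nat) (L : 'I_k -> 'M[R]_(m, n))
    X Y Z :
  sensing_bilin L X (Y + Z) = sensing_bilin L X Y + sensing_bilin L X Z.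
Proof.
rewrite -mulrDr -big_split /=; congr (_ * _).
by apply: eq_bigr => i _; rewrite mxdotDr mulrDr.
Qed.

Lemma sensing_bilinZr (R : realType) (m n k : nat) (L : 'I_k -> 'M[R]_(m, n))
    a X Y :
  sensing_bilin L X (a *: Y) = a * sensing_bilin L X Y.
Proof.
rewrite mulrCA mulr_sumr; congr (_ * _).
by apply: eq_bigr => i _; rewrite mxdotZr mulrCA.
Qed.

Lemma sensing_bilinNr (R : realType) (m n k : nat) (L : 'I_k -> 'M[R]_(m, n)) X Y :
  sensing_bilin L X (- Y) = - sensing_bilin L X Y.
Proof. by rewrite -scaleN1r sensing_bilinZr mulN1r. Qed.

Lemma sensing_bilinDl (R : realType) (m n k : nat) (L : 'I_k -> 'M[R]_(m, n))
    X Y Z :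
  sensing_bilin L (Y + Z) X = sensing_bilin L Y X + sensing_bilin L Z X.
Proof. by rewrite !(sensing_bilinC _ _ X) sensing_bilinDr. Qed.

Lemma sensing_bilinZl (R : realType) (m n k : nat) (L : 'I_k -> 'M[R]_(m, n))
    a X Y :
  sensing_bilin L (a *: Y) X = a * sensing_bilin L Y X.
Proof. by rewrite !(sensing_bilinC _ _ X) sensing_bilinZr. Qed.

Lemma sensing_bilinNl (R : realType) (m n k : nat) (L : 'I_k -> 'M[R]_(m, n)) X Y :
  sensing_bilin L (- Y) X = - sensing_bilin L Y X.
Proof. by rewrite !(sensing_bilinC _ _ X) sensing_bilinNr. Qed.

Definition sensing_bilin_lin := (sensing_bilinDl, sensing_bilinDr,
  sensing_bilinNl, sensing_bilinNr, sensing_bilinZl, sensing_bilinZr).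

Lemma sensing_lossE (R : realType) (m n k : nat) (L : 'I_k -> 'M[R]_(m, n))
    (b : 'I_k -> R) (Xs X : 'M[R]_(m, n)) :
  (forall i, b i = mxdot (L i) Xs) ->
  sensing_loss L b X = 2^-1 * sensing_bilin L (X - Xs) (X - Xs).
Proof.
move=> bE; rewrite /sensing_loss invfM -mulrA; congr (_ * (_ * _)).
by apply: eq_bigr => i _; rewrite bE mxdotDr mxdotNr expr2.
Qed.

Lemma sensing_formE (R : realType) (m n k : nat) (L : 'I_k -> 'M[R]_(m, n))
    (X : 'M[R]_(m, n)) :
  sensing_form L X = 2^-1 * sensing_bilin L X X.
Proof.
by rewrite /sensing_form invfM -mulrA.
Qed.

Lemma sensing_bilin_delta (R : realType) (m n k : nat) (L : 'I_k -> 'M[R]_(m, n))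
    (X Y : 'M[R]_(m, n)) :
  mxdot (\matrix_(i, j) sensing_bilin L X (delta_mx i j)) Y = sensing_bilin L X Y.
Proof.
have -> : \matrix_(i, j) sensing_bilin L X (delta_mx i j) =
    k%:R^-1 *: \sum_l mxdot (L l) X *: L l.
  apply/matrixP => i j; rewrite !mxE summxE; congr (_ * _).
  by apply: eq_bigr => l _; rewrite mxdot_delta mxE.
rewrite mxdotZl mxdotC (big_morph _ (mxdotDr Y) (mxdot0r Y)); congr (_ * _).
by apply: eq_bigr => l _; rewrite mxdotZr (mxdotC Y).
Qed.

Lemma mxdot_grad_loss (R : realType) (m n k : nat) (L : 'I_k -> 'M[R]_(m, n))
    (b : 'I_k -> R) (Xs X Y : 'M[R]_(m, n)) :
  (forall i, b i = mxdot (L i) Xs) ->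
  mxdot (grad (sensing_loss L b) X) Y = sensing_bilin L (X - Xs) Y.
Proof.
move=> bE; rewrite -sensing_bilin_delta; congr mxdot; apply/matrixP => i j.
rewrite !mxE; set D := X - Xs; set E := delta_mx i j.
rewrite (@derive_horner_line _ _ _ _ _ (Poly [:: 2^-1 * sensing_bilin L D D;
  sensing_bilin L D E; 2^-1 * sensing_bilin L E E])); first by rewrite coef_Poly.
move=> t; rewrite (sensing_lossE _ bE) addrAC horner_Poly /= -/D.
by clearbody D E; rewrite !sensing_bilin_lin (sensing_bilinC L E D); field.
Qed.

Lemma sensing_form_loss (R : realType) (m n k : nat) (L : 'I_k -> 'M[R]_(m, n)) :
  sensing_form L = sensing_loss L (fun=> 0).
Proof. by apply/funext => X; congr (_ * _); apply: eq_bigr => i _; rewrite subr0. Qed.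

(** A quadratic form equals its second-order expansion. Hence RSC and RSM become two-sided bounds on
    [sensing_bilin L] at differences of low-rank matrices. *)
Lemma sensing_form_bregman (R : realType) (m n k : nat) (L : 'I_k -> 'M[R]_(m, n))
    (X Y : 'M[R]_(m, n)) :
  sensing_form L Y - (sensing_form L X + mxdot (grad (sensing_form L) X) (Y - X)) =
  2^-1 * sensing_bilin L (X - Y) (X - Y).
Proof.
have zE i : 0 = mxdot (L i) 0 by rewrite mxdot0r.
rewrite {3}sensing_form_loss (mxdot_grad_loss _ _ zE) subr0 !sensing_formE.
by rewrite !sensing_bilin_lin (sensing_bilinC L Y X); field.
Qed.

Lemma sensing_class_le (R : realType) (m n r k : nat) (L : 'I_k -> 'M[R]_(m, n))
    (alpha beta : R) (X Y : 'M[R]_(m, n)) :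
  sensing_class alpha beta r L -> (\rank X <= r)%N -> (\rank Y <= r)%N ->
  alpha * mxdot (X - Y) (X - Y) <= sensing_bilin L (X - Y) (X - Y) /\
  sensing_bilin L (X - Y) (X - Y) <= beta * mxdot (X - Y) (X - Y).
Proof.
move=> [[_ /(_ X Y) lo] [_ /(_ X Y) hi]] rX rY.
move: (lo rX rY) (hi rX rY) (sensing_form_bregman L X Y).
by rewrite sqr_frob_norm => ? ? ?; split; lra.
Qed.

Lemma derive_factored (R : realType) (m n q k : nat) (L : 'I_k -> 'M[R]_(m, n))
    (b : 'I_k -> R) (Xs : 'M[R]_(m, n)) (Z V : 'M[R]_(m, q) * 'M[R]_(n, q)) :
  (forall i, b i = mxdot (L i) Xs) ->
  'D_V (factored (sensing_loss L b)) Z =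
  sensing_bilin L (Z.1 *m Z.2^T - Xs) (V.1 *m Z.2^T + Z.1 *m V.2^T).
Proof.
move=> bE; case: Z V => A B [U V] /=.
set D := A *m B^T - Xs; set W := _ + _; set T := U *m V^T.
(* The product of the moving factors is [A B^T + t W + t^2 T], so the loss is a quartic in [t]. *)
rewrite (@derive_horner_line _ _ _ _ _ (Poly [:: 2^-1 * sensing_bilin L D D;
  sensing_bilin L D W; 2^-1 * sensing_bilin L W W + sensing_bilin L D T;
  sensing_bilin L W T; 2^-1 * sensing_bilin L T T])); first by rewrite coef_Poly.
move=> t; rewrite /factored (sensing_lossE _ bE) horner_Poly /=.
have -> : (A + t *: U) *m (B + t *: V)^T - Xs = D + t *: W + (t * t) *: T.
  rewrite /D /W /T linearD linearZ /= mulmxDl !mulmxDr -!scalemxAl -!scalemxAr.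
  rewrite scalerA scalerDr !addrA; apply/matrixP => i j; rewrite !mxE; ring.
clearbody D W T.
rewrite !sensing_bilin_lin (sensing_bilinC L W D) (sensing_bilinC L T D).
by rewrite (sensing_bilinC L T W); field.
Qed.

Lemma hessian_factored (R : realType) (m n q k : nat) (L : 'I_k -> 'M[R]_(m, n))
    (b : 'I_k -> R) (Xs : 'M[R]_(m, n)) (Z V : 'M[R]_(m, q) * 'M[R]_(n, q)) :
  (forall i, b i = mxdot (L i) Xs) ->
  let W := V.1 *m Z.2^T + Z.1 *m V.2^T in
  hessian (factored (sensing_loss L b)) Z V V =
  2 * sensing_bilin L (Z.1 *m Z.2^T - Xs) (V.1 *m V.2^T) + sensing_bilin L W W.
Proof.
move=> bE; case: Z V => A B [U V] /=.
set D := A *m B^T - Xs; set W := U *m B^T + A *m V^T; set T := U *m V^T.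
(* The first derivative in the fixed direction is a cubic in [t], because [W] itself moves to
   [W + 2 t T]. *)
rewrite /hessian (@derive_horner_line _ _ _ _ _ (Poly [:: sensing_bilin L D W;
  2 * sensing_bilin L D T + sensing_bilin L W W; 3 * sensing_bilin L W T;
  2 * sensing_bilin L T T])); first by rewrite coef_Poly.
move=> t; rewrite (derive_factored _ _ bE) horner_Poly /=.
have -> : (A + t *: U) *m (B + t *: V)^T - Xs = D + t *: W + (t * t) *: T.
  rewrite /D /W /T linearD linearZ /= mulmxDl !mulmxDr -!scalemxAl -!scalemxAr.
  rewrite scalerA scalerDr !addrA; apply/matrixP => i j; rewrite !mxE; ring.
have -> : U *m (B + t *: V)^T + (A + t *: U) *m V^T = W + (2 * t) *: T.
  rewrite /W /T linearD linearZ /= mulmxDl !mulmxDr -!scalemxAl -!scalemxAr.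
  apply/matrixP => i j; rewrite !mxE; ring.
by clearbody D W T; rewrite !sensing_bilin_lin (sensing_bilinC L T W); ring.
Qed.

(** * Stationary points *)

Lemma mxdot_CauchySchwarz (R : realType) (m n : nat) (X Y : 'M[R]_(m, n)) :
  mxdot X Y ^+ 2 <= mxdot X X * mxdot Y Y.
Proof.
have [->|Y0] := eqVneq Y 0; first by rewrite !mxdot0r expr0n mulr0.
have := mxdot_ge0 (mxdot Y Y *: X - mxdot X Y *: Y).
rewrite !mxdot_lin (mxdotC Y X) => H.
rewrite -mxdot_gt0 in Y0.
by rewrite -subr_ge0 -(pmulr_rge0 _ Y0); lra.
Qed.

Lemma mxdot_mulmx_le (R : realType) (m n p : nat) (A : 'M[R]_(m, n))
    (B : 'M[R]_(n, p)) :
  mxdot (A *m B) (A *m B) <= mxdot A A * mxdot B B.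
Proof.
rewrite (mxdot_col B) (mxdot_col (A *m B)) mulr_sumr; apply: ler_sum => j _.
rewrite colE -mulmxA -colE; move: (col j B) => v.
rewrite (mxdotE A A) mulr_suml mxdotE; apply: ler_sum => i _.
have -> : \sum_j (A *m v) i j * (A *m v) i j = mxdot (row i A)^T v ^+ 2.
  rewrite big_ord1 mxE mxdotE expr2.
  by congr (_ * _); apply: eq_bigr => k _; rewrite big_ord1 !mxE.
apply: le_trans (mxdot_CauchySchwarz _ _) _.
rewrite ler_wpM2r ?mxdot_ge0 // mxdotE; apply: ler_sum => k _.
by rewrite big_ord1 !mxE.
Qed.

Lemma frob_norm_le (R : realType) (m n p q : nat) (A : 'M[R]_(m, n))
    (B : 'M[R]_(p, q)) :
  (frob_norm A <= frob_norm B) = (mxdot A A <= mxdot B B).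
Proof.
by rewrite -!sqr_frob_norm ler_pXn2r ?nnegrE ?frob_norm_ge0.
Qed.

Lemma frob_normZ (R : realType) (m n : nat) (a : R) (A : 'M[R]_(m, n)) :
  frob_norm (a *: A) = `|a| * frob_norm A.
Proof.
apply/eqP; rewrite -(eqrXn2 (n := 2)) ?mulr_ge0 ?frob_norm_ge0 //.
by rewrite exprMn !sqr_frob_norm real_normK ?num_real // !mxdot_lin mulrA.
Qed.

(** The Frobenius norm of [G] bounds the set of values on the unit ball, so the supremum is a
    genuine upper bound; homogeneity extends it to all vectors. *)
Lemma spectral_norm_bound (R : realType) (m n : nat) (G : 'M[R]_(m, n)) :
  0 <= spectral_norm G /\
  forall v : 'cV[R]_n, frob_norm (G *m v) <= spectral_norm G * frob_norm v.
Proof.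
have f0 p q : frob_norm (0 : 'M[R]_(p, q)) = 0.
  by apply/eqP; rewrite -sqrf_eq0 sqr_frob_norm mxdot0r.
have ub (v : 'cV[R]_n) : frob_norm v <= 1 -> frob_norm (G *m v) <= spectral_norm G.
  move=> v1; apply: sup_upper_bound; last by exists v.
  split; first by exists (frob_norm (G *m v)), v.
  exists (frob_norm G) => _ [u u1 <-]; rewrite frob_norm_le.
  apply: le_trans (mxdot_mulmx_le _ _) _; rewrite ler_piMr ?mxdot_ge0 //.
  by rewrite -sqr_frob_norm expr_le1 ?frob_norm_ge0.
split=> [|v]; first by have := ub 0; rewrite mulmx0 !f0; apply.
have [v0|v0] := eqVneq (frob_norm v) 0.
  move/eqP: (v0); rewrite -sqrf_eq0 sqr_frob_norm mxdot_eq0 => /eqP ->.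
  by rewrite mulmx0 !f0 mulr0.
have v_gt0 : 0 < frob_norm v by rewrite lt_def v0 frob_norm_ge0.
have := ub ((frob_norm v)^-1 *: v).
rewrite frob_normZ normfV ger0_norm ?frob_norm_ge0 // mulVf // lexx => /(_ isT).
by rewrite -scalemxAr frob_normZ normfV ger0_norm ?frob_norm_ge0 // mulrC ler_pdivrMr.
Qed.

Lemma affine_ge0_eq0 (R : realFieldType) (a c : R) :
  (forall s, 0 <= s * a + c) -> a = 0.
Proof.
move=> H; apply/eqP/contraT => a0; have := H (- (c + 1) / a).
by rewrite mulfVK //; lra.
Qed.

Lemma SOSP_factored (R : realType) (m n q k : nat) (L : 'I_k -> 'M[R]_(m, n))
    (b : 'I_k -> R) (Xs : 'M[R]_(m, n)) (A : 'M[R]_(m, q)) (B : 'M[R]_(n, q)) :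
  (forall i, b i = mxdot (L i) Xs) ->
  SOSP (factored (sensing_loss L b)) A B ->
  let G := grad (sensing_loss L b) (A *m B^T) in
  [/\ G *m B = 0, G^T *m A = 0
    & forall (U : 'M[R]_(m, q)) (V : 'M[R]_(n, q)),
        let W := U *m B^T + A *m V^T in
        0 <= 2 * mxdot G (U *m V^T) + sensing_bilin L W W].
Proof.
move=> bE [[gA gB] hess] G.
have GE Y := mxdot_grad_loss (A *m B^T) Y bE.
split=> [||U V].
- apply/matrixP => i j; rewrite [RHS]mxE.
  have : 'D_(delta_mx i j, 0) (factored (sensing_loss L b)) (A, B) = 0.
    by move/matrixP/(_ i j): gA; rewrite !mxE.
  rewrite (derive_factored _ _ bE) /= trmx0 mulmx0 addr0 -GE -/G => <-.
  by rewrite -mxdot_delta mxdotMr.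
- apply/matrixP => i j; rewrite [RHS]mxE.
  have : 'D_(0, delta_mx i j) (factored (sensing_loss L b)) (A, B) = 0.
    by move/matrixP/(_ i j): gB; rewrite !mxE.
  rewrite (derive_factored _ _ bE) /= mul0mx add0r -GE -/G => <-.
  by rewrite -mxdot_delta mxdotMl trmxK [RHS]mxdotC [RHS]mxdotMr trmxK.
by have := hess (U, V); rewrite (hessian_factored _ _ bE) /= -GE.
Qed.

(** If [B] has rank [q], then multiplication by [B^T] preserves rank, so the deficiency falls on
    [A]. *)
Lemma deficient_kernel (F : fieldType) (m n q : nat) (A : 'M[F]_(m, q))
    (B : 'M[F]_(n, q)) :
  (\rank (A *m B^T) < q)%N ->
  exists2 w : 'cV[F]_q, w != 0 & A *m w = 0 \/ B *m w = 0.
Proof.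
have ker p (C : 'M[F]_(p, q)) : (\rank C < q)%N ->
    exists2 w : 'cV[F]_q, w != 0 & C *m w = 0.
  move=> rC; have : kermx C^T != 0.
    by rewrite -mxrank_eq0 mxrank_ker mxrank_tr -lt0n subn_gt0.
  case/rowV0Pn => u /sub_kermxP uC u0; exists u^T; first by rewrite trmx_eq0.
  by apply: trmx_inj; rewrite trmx_mul trmxK trmx0.
move=> rAB; have [rB|rB] := ltnP (\rank B) q.
  by have [w w0 Bw] := ker _ _ rB; exists w => //; right.
have [w w0 Aw] : exists2 w : 'cV[F]_q, w != 0 & A *m w = 0; last by exists w; auto.
apply: ker; rewrite -(@mxrankMfree _ _ _ _ A B^T) //.
by rewrite -row_leq_rank mxrank_tr.
Qed.

(** With [U = u w^T] and [V = v^T w^T], scale the factor whose contribution to [W] vanishes: the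
    quadratic term stays constant, while the [G] term is linear in [s] with slope a nonzero multiple
    of [G i j]. *)
Lemma SOSP_deficient (R : realType) (m n q k : nat) (L : 'I_k -> 'M[R]_(m, n))
    (G : 'M[R]_(m, n)) (A : 'M[R]_(m, q)) (B : 'M[R]_(n, q)) :
  (forall (U : 'M[R]_(m, q)) (V : 'M[R]_(n, q)),
     let W := U *m B^T + A *m V^T in
     0 <= 2 * mxdot G (U *m V^T) + sensing_bilin L W W) ->
  (\rank (A *m B^T) < q)%N -> G = 0.
Proof.
move=> hess /deficient_kernel[w w0 ABw]; apply/matrixP => i j.
rewrite [RHS]mxE -mxdot_delta -(mul_delta_mx (0 : 'I_1)).
set u := delta_mx i 0; set v := delta_mx 0 j.
have wE : w^T *m w = (mxdot w w)%:M by rewrite [LHS]mx11_scalar /mxdot trace_mx11.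
have uvE : u *m w^T *m (v^T *m w^T)^T = mxdot w w *: (u *m v).
  by rewrite trmx_mul !trmxK -mulmxA (mulmxA w^T) wE mul_scalar_mx scalemxAr.
have ww : 2 * mxdot w w != 0 by rewrite mulf_neq0 // ?mxdot_eq0 // pnatr_eq0.
apply: (mulfI ww); rewrite mulr0.
case: ABw => [Aw|Bw].
  apply: (@affine_ge0_eq0 _ _
    (sensing_bilin L (u *m w^T *m B^T) (u *m w^T *m B^T))) => s.
  have := hess (u *m w^T) (s *: (v^T *m w^T)).
  have -> : A *m (s *: (v^T *m w^T))^T = 0.
    by rewrite linearZ /= trmx_mul trmxK -scalemxAr mulmxA Aw mul0mx scaler0.
  by rewrite addr0 linearZ /= -scalemxAr uvE !mxdotZr !mulrA (mulrC s).
apply: (@affine_ge0_eq0 _ _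
  (sensing_bilin L (A *m (v^T *m w^T)^T) (A *m (v^T *m w^T)^T))) => s.
have := hess (s *: (u *m w^T)) (v^T *m w^T).
have -> : s *: (u *m w^T) *m B^T = 0.
  by rewrite -scalemxAl -mulmxA -trmx_mul Bw trmx0 mulmx0 scaler0.
by rewrite add0r -scalemxAl uvE !mxdotZr !mulrA (mulrC s).
Qed.

Lemma mxdot_outer (R : realType) (m n : nat) (u x : 'cV[R]_m) (v y : 'cV[R]_n) :
  mxdot (u *m v^T) (x *m y^T) = mxdot u x * mxdot v y.
Proof.
rewrite mxdotMr trmxK -mulmxA; have -> : y^T *m v = (mxdot v y)%:M.
  by rewrite mxdotC [LHS]mx11_scalar /mxdot trace_mx11.
by rewrite mul_mx_scalar mxdotZr mulrC.
Qed.

(* Second-order stationarity is tested on the direction [(- c G v a^T, v b^T)],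
   where [b = B^T e] and [a = A^T X e] recover, through [A b = X e] and
   [B a = lam e], the singular directions of [X] from the unbalanced factors. *)
Lemma SOSP_full_rank (R : realType) (m n q k : nat) (L : 'I_k -> 'M[R]_(m, n))
    (alpha beta lam : R) (G : 'M[R]_(m, n)) (A : 'M[R]_(m, q)) (B : 'M[R]_(n, q))
    (e : 'cV[R]_n) :
  sensing_class alpha beta q L -> 0 < beta ->
  G^T *m A = 0 ->
  (forall (U : 'M[R]_(m, q)) (V : 'M[R]_(n, q)),
     let W := U *m B^T + A *m V^T in
     0 <= 2 * mxdot G (U *m V^T) + sensing_bilin L W W) ->
  0 < lam -> e != 0 -> let X := A *m B^T in X^T *m X *m e = lam *: e ->
  forall v : 'cV[R]_n,
    mxdot (G *m v) (G *m v) <= beta ^+ 2 * lam * mxdot v v.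
Proof.
move=> Lclass beta_gt0 GA hess lam_gt0 e0 X Xe v.
(* This [c] minimises the upper bound on the Hessian as a quadratic function of the scale of [U]. *)
pose c := (beta * lam)^-1.
pose b := B^T *m e; pose a := A^T *m (X *m e).
have Ab : A *m b = X *m e by rewrite /b mulmxA.
have Ba : B *m a = lam *: e.
  by rewrite -Xe /a !mulmxA [(A *m B^T)^T]trmx_mul trmxK.
have XeE : mxdot (X *m e) (X *m e) = lam * mxdot e e.
  by rewrite mxdotMl mulmxA Xe mxdotZr.
have ab : a^T *m b = (lam * mxdot e e)%:M.
  rewrite [LHS]mx11_scalar -XeE; congr _%:M.
  by rewrite /a trmx_mul trmxK -mulmxA Ab /mxdot trace_mx11.
clearbody a b.
have GvX : mxdot (G *m v) (X *m e) = 0.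
  by rewrite mxdotMl /X !mulmxA GA !mul0mx mxdot0r.
set U := - c *: (G *m v *m a^T); set V := v *m b^T.
have UV : mxdot G (U *m V^T) = - c * (lam * mxdot e e) * mxdot (G *m v) (G *m v).
  rewrite /U /V -scalemxAl trmx_mul trmxK -(mulmxA _ a^T) (mulmxA a^T) ab mul_scalar_mx.
  rewrite -scalemxAr !mxdotZr mulrA; congr (_ * _).
  by rewrite mxdotC [LHS]mxdotMr trmxK.
have W1 : U *m B^T = - c * lam *: (G *m v *m e^T).
  by rewrite /U -scalemxAl -(mulmxA _ a^T) -trmx_mul Ba linearZ /= -scalemxAr scalerA.
have W2 : A *m V^T = X *m e *m v^T by rewrite /V trmx_mul trmxK mulmxA Ab.
(* The sum [W] is the difference of [U *m B^T] and [- (A *m V^T)], each of rank at most [q], so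
   restricted smoothness applies to it whatever its own rank. *)
have rk : (\rank (U *m B^T) <= q)%N.
  by apply: leq_trans (mxrankM_maxl _ _) (rank_leq_col _).
have rk' : (\rank (- (A *m V^T)) <= q)%N.
  by rewrite mxrank_opp; apply: leq_trans (mxrankM_maxl _ _) (rank_leq_col _).
have [_] := sensing_class_le Lclass rk rk'; rewrite opprK => hi.
have := hess U V => /= /le_trans/(_ (lerD (lexx _) hi)).
rewrite UV W1 W2 !mxdot_lin !mxdot_outer XeE (mxdotC (X *m e)) GvX.
set g := mxdot (G *m v) _; set E := mxdot e e; set vv := mxdot v v => H.
have E_gt0 : 0 < E by rewrite mxdot_gt0.
have : 0 <= lam * E / (beta * lam) * (beta ^+ 2 * lam * vv - g).
  apply: le_trans H _; rewrite le_eqVlt; apply/orP; left; apply/eqP; rewrite /c.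
  by field; rewrite !gt_eqF.
by rewrite pmulr_rge0 ?subr_ge0 // divr_gt0 ?mulr_gt0.
Qed.

(** Both bounds are tested on a matrix unit, which has rank one and norm one. *)
Lemma sensing_class_alpha_le_beta (R : realType) (m n r k : nat)
    (L : 'I_k -> 'M[R]_(m, n)) (alpha beta : R) :
  (0 < m)%N -> (0 < n)%N -> (0 < r)%N ->
  sensing_class alpha beta r L -> alpha <= beta.
Proof.
move=> m0 n0 r0 Lclass; pose E : 'M[R]_(m, n) := delta_mx (Ordinal m0) (Ordinal n0).
have rE : (\rank E <= r)%N by rewrite mxrank_delta.
have r0' : (\rank (0%R : 'M[R]_(m, n)) <= r)%N by rewrite mxrank0.
have [lo hi] := sensing_class_le Lclass rE r0'.
have := le_trans lo hi; rewrite subr0.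
by rewrite mxdot_delta mxE !eqxx !mulr1.
Qed.

Lemma sensing_class_inj (R : realType) (m n r k : nat)
    (L : 'I_k -> 'M[R]_(m, n)) (alpha beta : R) (X Y : 'M[R]_(m, n)) :
  sensing_class alpha beta r L -> 0 < alpha ->
  (\rank X <= r)%N -> (\rank Y <= r)%N ->
  sensing_bilin L (X - Y) (X - Y) = 0 -> X = Y.
Proof.
move=> Lclass alpha_gt0 rX rY XY0; apply/eqP; rewrite -subr_eq0 -mxdot_eq0 eq_le.
rewrite mxdot_ge0 andbT -(pmulr_rle0 _ alpha_gt0) -XY0.
by have [] := sensing_class_le Lclass rX rY.
Qed.

Lemma SOSP_ground_truth (R : realType) (m n q k : nat) (L : 'I_k -> 'M[R]_(m, n))
    (b : 'I_k -> R) (Xs : 'M[R]_(m, n)) (alpha beta tau2 t : R)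
    (A : 'M[R]_(m, q)) (B : 'M[R]_(n, q)) :
  (forall i, b i = mxdot (L i) Xs) -> sensing_class alpha beta q L -> 0 < alpha ->
  (0 < q)%N -> (\rank Xs <= q)%N ->
  SOSP (factored (sensing_loss L b)) A B ->
  let X := A *m B^T in
  (\rank X = q ->
    [/\ forall v : 'cV[R]_n,
          mxdot (grad (sensing_loss L b) X *m v) (grad (sensing_loss L b) X *m v) <=
          tau2 * mxdot v v,
        t ^+ 2 * tau2 * (\rank Xs)%:R <= sigma X q ^+ 2 * q%:R
      & 1 < 2 * t * alpha]) ->
  X = Xs.
Proof.
move=> bE Lclass alpha_gt0 q_gt0 rXs sosp X full.
have [GB GA hess] := SOSP_factored bE sosp.
set G := grad _ _ in GB GA hess full.
have GE Y : mxdot G Y = sensing_bilin L (X - Xs) Y := mxdot_grad_loss _ _ bE.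
have rX : (\rank X <= q)%N by apply: leq_trans (mxrankM_maxl _ _) (rank_leq_col _).
have GX0 : mxdot G X = 0 by rewrite mxdotC mxdotMr trmxK GB mxdot0r.
have [Xlt|Xge] := ltnP (\rank X) q.
  apply: (sensing_class_inj Lclass alpha_gt0 rX rXs).
  by rewrite -GE (SOSP_deficient hess Xlt) mxdot0l.
have {}rX : \rank X = q by apply/eqP; rewrite eqn_leq rX.
have [Gle tle t_alpha] := full rX.
have rX_gt0 : (0 < \rank X)%N by rewrite rX.
have [_ _] := sigma_rank rX_gt0; rewrite rX => Xrow.
have XG : X^T *m G = 0.
  by apply: trmx_inj; rewrite trmx_mul trmxK mulmxA GA mul0mx trmx0.
have GX : G *m X^T = 0 by rewrite trmx_mul trmxK mulmxA GB mul0mx.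
have := low_rank_ineq XG GX (sqr_ge0 _) Gle Xrow.
rewrite rX => /(_ _ _ rXs tle); set D := mxdot _ _ => H.
have [lo _] := sensing_class_le Lclass (eq_leq rX) rXs.
move: lo; rewrite -/D -GE (mxdotDr G) mxdotNr GX0 => lo.
apply/eqP; rewrite -subr_eq0 -mxdot_eq0 -/D eq_le mxdot_ge0 andbT.
rewrite leNgt; apply/negP => D_gt0.
(* Once [t] is positive, [2 * t * alpha * D <= - 2 * t * mxdot G Xs <= D], which contradicts
   [1 < 2 * t * alpha] for positive [D]. *)
have t_gt0 : 0 < t by nra.
nra.
Qed.

Theorem lemma7 (R : realType) (m n r k : nat)
    (m_gt0 : (0 < m)%N) (n_gt0 : (0 < n)%N) (r_gt0 : (0 < r)%N)
    (k_gt0 : (0 < k)%N) (r_le_mn : (r <= minn m n)%N)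
    (Xs : 'M[R]_(m, n)) (rank_Xs : \rank Xs = r)
    (L : 'I_k -> 'M[R]_(m, n)) (b : 'I_k -> R)
    (bE : forall i, b i = mxdot (L i) Xs) :
  let f : 'M[R]_(m, n) -> R := sensing_loss L b in
  let g : forall q : nat, 'M[R]_(m, q) * 'M[R]_(n, q) -> R :=
    fun q => @factored R m n q f in
  [/\ forall alpha beta : R,
        sensing_class alpha beta r L -> beta < 2 * alpha ->
        forall (A : 'M[R]_(m, r)) (B : 'M[R]_(n, r)),
          SOSP (g r) A B -> A *m B^T = Xs,
      forall alpha beta : R,
        sensing_class alpha beta r L -> 0 < alpha ->
        forall (A : 'M[R]_(m, r)) (B : 'M[R]_(n, r)),
          SOSP (g r) A B -> neighborhood alpha r f (A *m B^T) ->
          A *m B^T = Xs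
    & forall (alpha' beta' : R) (r' : nat), (0 < r')%N ->
        sensing_class alpha' beta' r' L -> 0 < alpha' ->
        (beta' / alpha') ^+ 2 * r%:R < r'%:R ->
        (forall (A : 'M[R]_(m, r')) (B : 'M[R]_(n, r')),
           SOSP (g r') A B -> g r' (A, B) = 0) /\
        (forall (A : 'M[R]_(m, r')) (B : 'M[R]_(n, r')),
           g r' (A, B) = 0 -> A *m B^T = Xs)].
Proof.
move=> f g.
have grad_le q alpha beta (A : 'M[R]_(m, q)) (B : 'M[R]_(n, q)) :
    sensing_class alpha beta q L -> 0 < beta -> (0 < q)%N ->
    SOSP (g q) A B -> \rank (A *m B^T) = q ->
    forall v : 'cV[R]_n,
      mxdot (grad f (A *m B^T) *m v) (grad f (A *m B^T) *m v) <=
      beta ^+ 2 * sigma (A *m B^T) q ^+ 2 * mxdot v v.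
  move=> Lclass beta_gt0 q_gt0 sosp rX.
  have [_ GA hess] := SOSP_factored bE sosp.
  have rX_gt0 : (0 < \rank (A *m B^T))%N by rewrite rX.
  have [s_gt0 [e e0 Xe] _] := sigma_rank rX_gt0; rewrite rX in s_gt0 Xe.
  exact: (SOSP_full_rank Lclass beta_gt0 GA hess (exprn_gt0 2 s_gt0) e0 Xe).
have rXs : (\rank Xs <= r)%N by rewrite rank_Xs.
split.
- move=> alpha beta Lclass beta_lt A B sosp.
  have le_ab := sensing_class_alpha_le_beta m_gt0 n_gt0 r_gt0 Lclass.
  (* From [alpha <= beta < 2 * alpha]. *)
  have alpha_gt0 : 0 < alpha by lra.
  have beta_gt0 : 0 < beta by lra.
  (* With [t = beta^-1] the rank condition is an equality, and [1 < 2 * t * alpha] is exactly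
     [beta < 2 * alpha]. *)
  apply: (@SOSP_ground_truth _ _ _ _ _ _ _ _ _ _
    (beta ^+ 2 * sigma (A *m B^T) r ^+ 2) beta^-1 _ _ bE Lclass
    alpha_gt0 r_gt0 rXs sosp).
  move=> rX; split; first exact: (grad_le _ _ _ _ _ Lclass).
    by rewrite rank_Xs mulrA -exprMn mulVf ?gt_eqF // expr1n mul1r.
  by rewrite mulrAC ltr_pdivlMr // mul1r.
- move=> alpha beta Lclass alpha_gt0 A B sosp [rX nbX].
  set X := A *m B^T in rX nbX *.
  have [S_ge0 S_bound] := spectral_norm_bound (grad f X).
  set S := spectral_norm _ in nbX S_ge0 S_bound.
  (* A midpoint is taken because [S] may be zero: [tau] is positive, still bounds the gradient, and
     [t = sigma X r / tau] gives [1 < 2 * t * alpha]. *)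
  pose tau := (S + 2 * alpha * sigma X r) / 2.
  apply: (@SOSP_ground_truth _ _ _ _ _ _ _ _ _ _
    (tau ^+ 2) (sigma X r / tau) _ _ bE Lclass
    alpha_gt0 r_gt0 rXs sosp).
  rewrite -/X => {}rX; case: nbX => [|S_lt]; first by rewrite rX ltnn.
  have [S_tau tau_lt] := midf_lt S_lt; rewrite -/tau in S_tau tau_lt.
  clearbody tau; have tau_gt0 : 0 < tau by exact: le_lt_trans S_tau.
  split=> [v||].
  + rewrite -!sqr_frob_norm -exprMn.
    rewrite ler_pXn2r ?nnegrE ?mulr_ge0 ?frob_norm_ge0 ?(ltW tau_gt0) //.
    by apply: le_trans (S_bound v) _; rewrite ler_wpM2r ?frob_norm_ge0 // ltW.
  + by rewrite rank_Xs -exprMn mulfVK ?gt_eqF.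
  + by rewrite mulrA mulrAC ltr_pdivlMr // mul1r mulrAC.
move=> alpha beta q q_gt0 Lclass alpha_gt0 q_big.
have le_ab := sensing_class_alpha_le_beta m_gt0 n_gt0 q_gt0 Lclass.
(* Since [1 <= beta / alpha], the overparametrisation bound forces [r <= q]. *)
have {}rXs : (\rank Xs <= q)%N.
  rewrite rank_Xs -(ler_nat R); apply: le_trans (ltW q_big).
  by rewrite ler_peMl // exprn_ege1 // ler_pdivlMr ?mul1r.
have beta_gt0 : 0 < beta by lra.
split=> A B.
  move=> sosp; suff XE : A *m B^T = Xs.
    rewrite /g /factored /f /= XE (sensing_lossE _ bE) subrr -(scale0r 0).
    by rewrite sensing_bilinZr mul0r mulr0.
  (* With [t = alpha^-1] the last condition reads [1 < 2], and the rank condition is [q_big]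
     multiplied by the squared singular value. *)
  apply: (@SOSP_ground_truth _ _ _ _ _ _ _ _ _ _
    (beta ^+ 2 * sigma (A *m B^T) q ^+ 2) alpha^-1 _ _ bE Lclass
    alpha_gt0 q_gt0 rXs sosp) => rX.
  split; first exact: (grad_le _ _ _ _ _ Lclass).
    rewrite rank_Xs mulrA -exprMn [_^-1 * _]mulrC mulrAC [leRHS]mulrC.
    by rewrite ler_wpM2r ?sqr_ge0 // ltW.
  by rewrite -mulrA mulVf ?gt_eqF // mulr1; lra.
rewrite /g /factored /f /= (sensing_lossE _ bE) => g0.
apply: (sensing_class_inj Lclass alpha_gt0 _ rXs); last by lra.
by apply: leq_trans (mxrankM_maxl _ _) (rank_leq_col _).
Qed.
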